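(* Let $\Omega=[0,1]^2$, let $A_1\in L^\infty(\Omega;\mathbb{R}^{2\times 2})$ be symmetric, $\Omega$-periodic and uniformly elliptic with constants $0<\alpha\le\beta$, and let $A_\varepsilon(x):=A_1(x/\varepsilon)$. Let the mesh size $H$ be an integer multiple of $\varepsilon$ and let the localization parameter $\ell\in\mathbb{N}_0$ be chosen of order $\ell\approx|\log H|$. Then $$\|A_H^\infty-A_H^\ell\|_{L^\infty(\Omega)}\lesssim H .$$ Precisely: there is a constant $c_1>0$, independent of $H$ and $\varepsilon$, such that for every $c_2\ge c_1$ there is a constant $C>0$, independent of $H$, $\varepsilon$ and $\ell$, such that $\|A_H^\infty-A_H^\ell\|_{L^\infty(\Omega)}\le C\,H$ whenever $H$ is an integer multiple of $\varepsilon$ and $c_1|\log H|\le\ell\le c_2|\log H|$.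
   Context: **Setting.** $\Omega=[0,1]^2$. The coefficient $A_1\in L^\infty(\Omega;\mathbb{R}^{2\times2})$ is symmetric, extended $\Omega$-periodically to $\mathbb{R}^2$, and satisfies $\alpha|\xi|^2\le \xi\cdot A_1(x)\xi\le\beta|\xi|^2$ for all $\xi\in\mathbb{R}^2$ and a.a. $x$, with $0<\alpha\le\beta$. Set $A_\varepsilon(x)=A_1(x/\varepsilon)$. $V:=H^1_\#(\Omega)/\mathbb{R}$ is the space of $\Omega$-periodic $H^1$ functions modulo constants, and $a_\varepsilon(u,v)=\int_\Omega A_\varepsilon\nabla u\cdot\nabla v\,dx$, an inner product on $V$. $(e_1,e_2)$ is the canonical basis of $\mathbb{R}^2$. **Meshes.** $\mathcal{Q}_H$ is the uniform partition of $\Omega$ into squares of side length $H$ (so $1/H$ is a positive integer), and $\mathcal{T}_H$ is the structured triangulation obtained by splitting every square of $\mathcal{Q}_H$ into two triangles by a diagonal, with the same diagonal direction in all squares; both have the same set of nodes. Both are understood as periodic partitions (opposite faces of the unit square are identified; equivalently they are continued periodically to $\mathbb{R}^2$). Here $0<\varepsilon\le H$; since $H$ is an integer multiple of $\varepsilon$, $1/\varepsilon$ is an integer and $A_\varepsilon$ is $\Omega$-periodic. **Finite element space and quasi-interpolation.** $\mathcal{P}_1(\mathcal{T}_H)$ is the space of globally continuous, $\Omega$-periodic, $\mathcal{T}_H$-piecewise affine functions, modulo constants. The operator $I_H=E_H\circ\Pi_H:V\to\mathcal{P}_1(\mathcal{T}_H)$ is defined as follows: $\Pi_H v$ is, on each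 $T\in\mathcal{T}_H$, the $L^2(T)$-orthogonal projection of $v$ onto the affine functions on $T$; and $E_H\Pi_Hv$ is the continuous piecewise affine function whose value at each vertex $z$ is $$\frac{1}{\#\{T\in\mathcal{T}_H: z\in T\}}\sum_{T\in\mathcal{T}_H,\ z\in T}(\Pi_Hv)|_T(z),$$ with the triangulation understood periodically. Let $W:=\ker I_H\subset V$. **Ideal correctors and coefficient.** For $Q\in\mathcal{Q}_H$ and $j=1,2$ let $q^\infty_{Q,j}\in W$ be the unique solution of $$\int_\Omega A_\varepsilon\nabla q^\infty_{Q,j}\cdot\nabla w\,dx=\int_Q A_\varepsilon e_j\cdot\nabla w\,dx\quad\text{for all }w\in W,$$ and define the $\mathcal{Q}_H$-piecewise constant matrix $A_H^\infty$ by $$\bigl(A^\infty_H|_Q\bigr)_{kj}=\frac1{|Q|}\int_Q A_\varepsilon e_j\cdot e_k\,dx-\frac1{|Q|}\int_\Omega A_\varepsilon\nabla q^\infty_{Q,j}\cdot e_k\,dx .$$ **Subspace decomposition.** Let $z_1,\dots,z_n$ be the vertices of the periodic mesh. Let $\omega_i$ be the union of all squares of $\mathcal{Q}_H$ having $z_i$ as a corner, regarded as a subset of $\mathbb{R}^2$ (continued over the periodic boundary). Set $W_i=\{v-I_Hv \mid v\in H^1_0(\omega_i)\}$, where functions in $H^1_0(\omega_i)$ are extended by zero and periodized; the $W_i$ are closed subspaces of $W$. Let $P_i:V\to W_i$ be the $a_\varepsilon$-orthogonal projection, $a_\varepsilon(P_iv,w_i)=a_\varepsilon(v,w_i)$ for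 all $w_i\in W_i$, and $P=P_1+\dots+P_n$. **Known result used to fix the scaling factor $\vartheta$.** There are constants $K_1,K_2>0$, independent of $H$ and $\varepsilon$, such that $K_1^{-1}a_\varepsilon(v,v)\le a_\varepsilon(Pv,v)\le K_2a_\varepsilon(v,v)$ for all $v\in W$. Consequently there are a scaling factor $\vartheta>0$ depending only on $K_1,K_2$ and a constant $0<\gamma<1$ independent of $H$ and $\varepsilon$ such that $\|\mathrm{id}-\vartheta P\|_{\mathcal{L}(W,W)}\le\gamma$ in the operator norm induced by the energy norm $a_\varepsilon(\cdot,\cdot)^{1/2}$. Such a $\vartheta$ is fixed. **Localized correctors and coefficient.** Starting from $q^0_{Q,j}=0$, define $$q^{\ell+1}_{Q,j}=q^\ell_{Q,j}+\vartheta P(x_j 1_Q-q^\ell_{Q,j}),\qquad j=1,2,$$ where $1_Q$ is the characteristic function of $Q$, and $P(x_j1_Q-q^\ell_{Q,j})=\sum_i C_i^\ell$ with $C_i^\ell\in W_i$ the solution of $$a_\varepsilon(C_i^\ell,w_i)=\int_Q A_\varepsilon e_j\cdot\nabla w_i\,dx-a_\varepsilon(q^\ell_{Q,j},w_i)\quad\text{for all }w_i\in W_i$$ (that is, $a_\varepsilon(x_j1_Q,w_i)$ is by convention $\int_Q A_\varepsilon e_j\cdot\nabla w_i\,dx$). The $\mathcal{Q}_H$-piecewise constant matrix $A_H^\ell$ is $$\bigl(A^\ell_H|_Q\bigr)_{kj}=\frac1{|Q|}\int_Q A_\varepsilon e_j\cdot e_k\,dx-\frac1{|Q|}\int_\Omega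 A_\varepsilon\nabla q^\ell_{Q,j}\cdot e_k\,dx .$$ The $L^\infty(\Omega)$ norm of a matrix-valued function is taken with respect to any fixed matrix norm. The constants may depend on $\alpha,\beta,\vartheta,\gamma$ (and $C$ also on $c_2$). *)

(* Defs.v *)
From HB Require Import structures.
From mathcomp Require Import all_boot all_order all_algebra finmap.
From mathcomp Require Import all_classical all_reals all_analysis.

Set Implicit Arguments.
Unset Strict Implicit.
Unset Printing Implicit Defensive.

Import Order.TTheory GRing.Theory Num.Theory.
Import numFieldNormedType.Exports.
Local Open Scope classical_set_scope.
Local Open Scope ring_scope.

(* [measurableTypeR R] is convertible to [R]; with it the product carries both
   the Borel sigma-algebra expected by [lebesgue_measure] and the usual normed
   space structure of R^2. *)
Notation plane R := (measurableTypeR R * measurableTypeR R)%type.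

Definition leb2 (R : realType) : {measure set (plane R) -> \bar R} :=
  (@lebesgue_measure R \x @lebesgue_measure R)%E.

Definition Omega (R : realType) : set (plane R) :=
  [set x | 0 <= x.1 <= 1 /\ 0 <= x.2 <= 1].

Definition translate (R : realType) (x : plane R) (m : int * int) : plane R :=
  (x.1 + m.1%:~R, x.2 + m.2%:~R).

Definition Zperiodic (R : realType) (T : Type) (f : plane R -> T) : Prop :=
  forall x m, f (translate x m) = f x.

Definition dot (R : realType) (xi eta : 'cV[R]_2) : R := (xi^T *m eta) 0 0.

Definition evec (R : realType) (j : 'I_2) : 'cV[R]_2 := delta_mx j 0.

(* The same basis vectors, as directions of differentiation in [plane R]. *)
Definition dir (R : realType) (k : 'I_2) : plane R :=
  if k == 0 then (1, 0) else (0, 1).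

(* An element of L^oo is represented by a Borel function that is periodic
   everywhere; the other conditions hold almost everywhere. *)
Definition coefficient (R : realType) (alpha beta : R)
    (A : plane R -> 'M[R]_2) : Prop :=
  [/\ forall k j, measurable_fun setT (fun x => A x k j),
      forall k j, (Lnorm (leb2 R) +oo (fun x => (A x k j)%:E) < +oo)%E,
      Zperiodic A,
      \forall x \ae leb2 R, (A x)^T = A x &
      \forall x \ae leb2 R, forall xi : 'cV[R]_2,
        alpha * dot xi xi <= dot xi (A x *m xi) <= beta * dot xi xi].

Definition rescale (R : realType) (eps : R) (A1 : plane R -> 'M[R]_2)
  : plane R -> 'M[R]_2 := fun x => A1 (x.1 / eps, x.2 / eps).

Fixpoint Cn (R : realType) (n : nat) (f : plane R -> R) : Prop :=
  if n is n'.+1 then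
    continuous f /\
    forall k, (forall x, derivable f x (dir R k)) /\
              Cn n' (fun x => 'D_(dir R k) f x)
  else continuous f.

Definition test_function (R : realType) (U : set (plane R))
    (phi : plane R -> R) : Prop :=
  [/\ forall n, Cn n phi,
      compact (closure [set x | phi x != 0]) &
      closure [set x | phi x != 0] `<=` U].

(* A weakly differentiable function together with its weak gradient. *)
Notation jet R := ((plane R -> R) * (plane R -> 'cV[R]_2))%type.

(* H^1_#(Omega).  Testing against functions on the whole plane excludes jumps
   across the boundary of Omega.  The quotient by constants is taken into
   account in [inW] and [inWz]; everything else depends on gradients only. *)
Definition H1per (R : realType) (u : jet R) : Prop :=
  [/\ measurable_fun setT u.1 /\
        forall k, measurable_fun setT (fun x => u.2 x k 0),
      Zperiodic u.1 /\ Zperiodic u.2,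
      (leb2 R).-integrable (@Omega R) (fun x => (u.1 x ^+ 2)%:E),
      forall k, (leb2 R).-integrable (@Omega R) (fun x => (u.2 x k 0 ^+ 2)%:E) &
      forall phi k, test_function setT phi ->
        \int[leb2 R]_x (u.1 x * 'D_(dir R k) phi x) =
        - \int[leb2 R]_x (u.2 x k 0 * phi x)].

(* H^1_0 of the interior of U: closure of the test functions in the H^1 norm,
   each element being extended by zero to the plane. *)
Definition H10 (R : realType) (U : set (plane R)) (v : jet R) : Prop :=
  [/\ measurable_fun setT v.1 /\
        forall k, measurable_fun setT (fun x => v.2 x k 0),
      forall x, ~ U x -> v.1 x = 0 /\ v.2 x = 0 &
      forall e : R, 0 < e -> exists2 phi, test_function (interior U) phi &
        (\int[leb2 R]_x ((v.1 x - phi x) ^+ 2)%:E +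
         \sum_(k < 2) \int[leb2 R]_x ((v.2 x k 0 - 'D_(dir R k) phi x) ^+ 2)%:E
         < e%:E)%E].

Definition periodize (R : realType) (f : plane R -> R) : plane R -> R :=
  fun x => \sum_(m \in [set: int * int]) f (translate x m).

(* Squares of the periodically continued mesh are indexed by the integer
   coordinates of their lower left corners, nodes by their own. *)
Definition node (R : realType) (H : R) (z : int * int) : plane R :=
  (z.1%:~R * H, z.2%:~R * H).

Definition square (R : realType) (H : R) (s : int * int) : set (plane R) :=
  [set x | s.1%:~R * H <= x.1 <= (s.1 + 1)%:~R * H /\
           s.2%:~R * H <= x.2 <= (s.2 + 1)%:~R * H].

Definition corner (s z : int * int) : Prop :=
  (z.1 = s.1 \/ z.1 = s.1 + 1) /\ (z.2 = s.2 \/ z.2 = s.2 + 1).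

Definition omega (R : realType) (H : R) (z : int * int) : set (plane R) :=
  \bigcup_(s in [set s | corner s z]) square H s.

(* Triangle (s, b) is one of the halves of the square s.  The parameter d
   selects the diagonal, the same in every square: the one through the lower
   left corner for d = false, the one through the upper left corner for
   d = true. *)
Definition triangle (R : realType) (d : bool) (H : R) (t : (int * int) * bool)
    : set (plane R) :=
  [set x | square H t.1 x /\
    let a := x.1 - t.1.1%:~R * H in
    let b := x.2 - t.1.2%:~R * H in
    let g := if d then a + b - H else b - a in
    if t.2 then 0 <= g else g <= 0].

Definition affine (R : realType) (p : plane R -> R) : Prop :=
  exists c0 c1 c2 : R, forall x, p x = c0 + c1 * x.1 + c2 * x.2.

(* Continuous, periodic, piecewise affine functions (not modulo constants). *)
Definition P1 (R : realType) (d : bool) (H : R) (p : plane R -> R) : Prop :=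
  [/\ continuous p, Zperiodic p &
      forall t, exists2 q, affine q & {in triangle d H t, p =1 q}].

Definition L2proj (R : realType) (T : set (plane R)) (v p : plane R -> R)
    : Prop :=
  affine p /\
  forall q, affine q -> \int[leb2 R]_(x in T) ((v x - p x) * q x) = 0.

Definition triangles_at (R : realType) (d : bool) (H : R) (z : int * int)
    : set ((int * int) * bool) :=
  [set t | triangle d H t (node H z)].

(* p = I_H v = E_H (Pi_H v), where q t is (Pi_H v)|_t. *)
Definition is_IH (R : realType) (d : bool) (H : R) (v p : plane R -> R)
    : Prop :=
  P1 d H p /\
  exists2 q : (int * int) * bool -> plane R -> R,
    forall t, L2proj (triangle d H t) v (q t) &
    forall z, p (node H z) =
      (#|` fset_set (triangles_at d H z)|%fset)%:R^-1 *
      \sum_(t \in triangles_at d H z) q t (node H z).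

(* W, the kernel of I_H on H^1_# modulo constants. *)
Definition inW (R : realType) (d : bool) (H : R) (v : jet R) : Prop :=
  H1per v /\ exists c : R, is_IH d H v.1 (fun=> c).

(* The space W_i attached to the vertex z; equality is in H^1_# modulo
   constants. *)
Definition inWz (R : realType) (d : bool) (H : R) (z : int * int) (w : jet R)
    : Prop :=
  H1per w /\
  exists (v : jet R) (p : plane R -> R) (c : R),
    [/\ H10 (omega H z) v, is_IH d H (periodize v.1) p &
        \forall x \ae leb2 R, w.1 x = periodize v.1 x - p x + c].

Definition aform (R : realType) (A : plane R -> 'M[R]_2) (u v : jet R) : R :=
  \int[leb2 R]_(x in @Omega R) dot (A x *m u.2 x) (v.2 x).

Definition enorm (R : realType) (A : plane R -> 'M[R]_2) (u : jet R) : R :=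
  Num.sqrt (aform A u u).

(* a(x_j 1_Q, w) *)
Definition load (R : realType) (A : plane R -> 'M[R]_2) (Q : set (plane R))
    (j : 'I_2) (w : jet R) : R :=
  \int[leb2 R]_(x in Q) dot (A x *m evec R j) (w.2 x).

Definition admissible (R : realType) (N m : nat) (H eps : R) : Prop :=
  [/\ (0 < N)%N, (0 < m)%N, 0 < eps, H = N%:R^-1 & H = m%:R * eps].

(* Squares and vertices of the periodic mesh with 1/H = N: one representative
   of each in [0,1)^2. *)
Notation idx N := ('I_N * 'I_N)%type.

Definition coords (N : nat) (i : idx N) : int * int :=
  (Posz (val i.1), Posz (val i.2)).

Definition is_proj (R : realType) (A : plane R -> 'M[R]_2) (d : bool) (H : R)
    (z : int * int) (v p : jet R) : Prop :=
  inWz d H z p /\ forall w, inWz d H z w -> aform A p w = aform A v w.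

(* The norm of id - theta P on W is at most gamma. *)
Definition energy_contraction (R : realType) (A : plane R -> 'M[R]_2) (d : bool)
    (N : nat) (H theta gamma : R) : Prop :=
  forall (v : jet R) (p : idx N -> jet R),
    inW d H v -> (forall i, is_proj A d H (coords i) v (p i)) ->
    enorm A (v - theta *: \sum_i p i) <= gamma * enorm A v.

Definition ideal_correctors (R : realType) (A : plane R -> 'M[R]_2) (d : bool)
    (N : nat) (H : R) (q : idx N -> 'I_2 -> jet R) : Prop :=
  forall Q j, inW d H (q Q j) /\
    forall w, inW d H w -> aform A (q Q j) w = load A (square H (coords Q)) j w.

(* q l is the l-th iterate and C l Q j i the component in W_i of
   P (x_j 1_Q - q l Q j). *)
Definition localized_correctors (R : realType) (A : plane R -> 'M[R]_2)
    (d : bool) (N : nat) (H theta : R) (q : nat -> idx N -> 'I_2 -> jet R)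
    : Prop :=
  exists C : nat -> idx N -> 'I_2 -> idx N -> jet R,
  forall Q j,
    q 0%N Q j = 0 /\
    forall l,
      (forall i, inWz d H (coords i) (C l Q j i) /\
         forall w, inWz d H (coords i) w ->
           aform A (C l Q j i) w =
           load A (square H (coords Q)) j w - aform A (q l Q j) w) /\
      q l.+1 Q j = q l Q j + theta *: \sum_i C l Q j i.

(* The coefficient on the square Q; its area is H^2. *)
Definition coef_on (R : realType) (A : plane R -> 'M[R]_2) (N : nat) (H : R)
    (q : idx N -> 'I_2 -> jet R) (Q : idx N) : 'M[R]_2 :=
  \matrix_(k, j)
    ((H ^+ 2)^-1 * \int[leb2 R]_(x in square H (coords Q))
        dot (A x *m evec R j) (evec R k)
     - (H ^+ 2)^-1 * \int[leb2 R]_(x in @Omega R)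
        dot (A x *m (q Q j).2 x) (evec R k)).

(* Half-open squares, so that the pieces do not overlap. *)
Definition cell (R : realType) (H : R) (s : int * int) : set (plane R) :=
  [set x | s.1%:~R * H <= x.1 < (s.1 + 1)%:~R * H /\
           s.2%:~R * H <= x.2 < (s.2 + 1)%:~R * H].

Definition pwconst (R : realType) (N : nat) (H : R) (F : idx N -> 'M[R]_2)
    : plane R -> 'M[R]_2 :=
  fun x => \sum_Q \1_(cell H (coords Q)) x *: F Q.

Definition AH (R : realType) (A : plane R -> 'M[R]_2) (N : nat) (H : R)
    (q : idx N -> 'I_2 -> jet R) : plane R -> 'M[R]_2 :=
  pwconst H (coef_on A H q).

Definition is_mxnorm (R : realType) (nrm : 'M[R]_2 -> R) : Prop :=
  [/\ forall M, nrm M = 0 -> M = 0,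
      forall (a : R) M, nrm (a *: M) = `|a| * nrm M &
      forall M M', nrm (M + M') <= nrm M + nrm M'].

Definition Linf (R : realType) (nrm : 'M[R]_2 -> R)
    (M : plane R -> 'M[R]_2) : \bar R :=
  Lnorm (leb2 R) +oo ((fun x => (nrm (M x))%:E) \_ (@Omega R)).

(* Main.v *)
From HB Require Import structures.
Require Import Defs.
From mathcomp Require Import all_boot all_order all_algebra.
From mathcomp Require Import all_classical all_reals all_analysis.
From mathcomp Require Import finmap measurable_realfun ess_sup_inf zify ring lra.
Set Implicit Arguments.
Unset Strict Implicit.
Unset Printing Implicit Defensive.
Import Order.TTheory GRing.Theory Num.Theory.
Import numFieldNormedType.Exports.
Local Open Scope classical_set_scope.
Local Open Scope ring_scope.

(** Each step of the iteration is one application of id - theta P to the error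
    e_l = q^oo - q^l, because the right-hand side of the problem for C_i^l is
    a(e_l, .) on W_i.  Hence |||e_l||| <= gamma^l |||q^oo|||, and testing the
    problem for q^oo with q^oo itself gives |||q^oo|||^2 <= beta H^2.  By the
    weighted inequality |A xi . eta| <= s/2 A xi . xi + 1/(2s) A eta . eta with
    s = 1 / (gamma^l H), an entry of A_H^oo - A_H^l on a square is then at most
    H^-2 (beta gamma^l H), which is at most beta H as soon as gamma^l <= H^2.
    This last condition is l >= 2 |ln H| / |ln gamma|.

    The step where W_i is used as a subspace of W = ker I_H amounts to
    I_H (v - I_H v) = 0: the projection of v - p onto the affine functions on a
    triangle is that of v minus p, so averaging at a node gives p - p. *)

(** * Lebesgue measure under affine maps of the line and of the plane *)

Section affine_maps.
Context (R : realType).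

Definition affine1 (a b : R) (x : measurableTypeR R) : measurableTypeR R :=
  a * x + b.

(** One ratio for both coordinates covers the two maps in use: lattice translations ([a] = 1) and
    the rescaling by $1/\varepsilon$. *)
Definition affine_map (a b c : R) (x : plane R) : plane R :=
  (a * x.1 + b, a * x.2 + c).

Lemma measurable_affine1 (a b : R) :
  measurable_fun setT (affine1 a b).
Proof. by apply: measurable_funD => //; apply: measurable_funM. Qed.

Lemma measurable_affine_map (a b c : R) : measurable_fun setT (affine_map a b c).
Proof.
apply/measurable_fun_pairP; split.
  by apply: (measurableT_comp (measurable_affine1 a b)).
by apply: (measurableT_comp (measurable_affine1 a c)).
Qed.

(** By uniqueness of Lebesgue measure: [a] times the pushforward gives every half-open interval its
    length. *)
Lemma lebesgue_measure_affine (a b : R) (B : set (measurableTypeR R)) :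
  0 < a -> measurable B ->
  @lebesgue_measure R (affine1 a b @^-1` B) =
  ((a^-1)%:E * @lebesgue_measure R B)%E.
Proof.
move=> a0 mB.
pose nu_ : {measure set (measurableTypeR R) -> \bar R} :=
  mscale (NngNum (ltW a0))
    (pushforward (@lebesgue_measure R) (affine1 a b)).
pose nu := nu_ (measurable_affine1 a b).
rewrite (@lebesgue_measure_unique R nu _ B mB).
  rewrite /nu /= /mscale /= /pushforward muleA -EFinM mulVf ?gt_eqF//.
  by rewrite mul1e.
move=> _ [[c d]] _ <-.
rewrite /nu /= /mscale /= /pushforward /=.
have -> : affine1 a b @^-1` `]c, d] = `](c - b) / a, (d - b) / a]%classic.
  apply/seteqP; split => x /=; rewrite !in_itv/= ltr_pdivrMr// ler_pdivlMr//;
    by rewrite ltrBlDr lerBrDr mulrC.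
rewrite !lebesgue_measure_itv/= !lte_fin ltr_pM2r ?invr_gt0// ltrD2r.
case: ifPn => cd; last by rewrite mule0.
rewrite -!EFinB -EFinM; congr EFin; field.
by rewrite gt_eqF.
Qed.

Lemma leb2X (C D : set (measurableTypeR R)) : measurable C -> measurable D ->
  leb2 R (C `*` D) = (@lebesgue_measure R C * @lebesgue_measure R D)%E.
Proof. exact: product_measure1E. Qed.

(** By uniqueness of the product measure it suffices to compare on products of measurable sets,
    where each factor contributes $1/a$. *)
Lemma leb2_affine (a b c : R) (B : set (plane R)) : 0 < a -> measurable B ->
  leb2 R (affine_map a b c @^-1` B) = ((a ^- 2)%:E * leb2 R B)%E.
Proof.
move=> a0 mB; have a20 : 0 <= a ^+ 2 by rewrite exprn_ge0// ltW.
pose nu_ : {measure set (plane R) -> \bar R} :=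
  mscale (NngNum a20) (pushforward (leb2 R) (affine_map a b c)).
pose nu := nu_ (measurable_affine_map a b c).
have -> : leb2 R B = nu B.
  apply: product_measure_unique mB => C D mC mD.
  rewrite /nu /= /mscale /= /pushforward /=.
  have -> : affine_map a b c @^-1` (C `*` D) =
      affine1 a b @^-1` C `*` (affine1 a c @^-1` D) by [].
  rewrite leb2X; last 2 first.
  - by rewrite -[X in measurable X]setTI; apply: measurable_affine1.
  - by rewrite -[X in measurable X]setTI; apply: measurable_affine1.
  rewrite [X in (_ * (X * _))%E](lebesgue_measure_affine b a0 mC).
  rewrite [X in (_ * (_ * X))%E](lebesgue_measure_affine c a0 mD).
  rewrite muleACA [LHS]muleA.
  suff -> : ((a ^+ 2)%:E * ((a^-1)%:E * (a^-1)%:E) = 1)%E by rewrite mul1e.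
  by rewrite -!EFinM; congr EFin; field; rewrite gt_eqF.
rewrite /nu /= /mscale /= /pushforward muleA -EFinM mulVf ?mul1e//.
by rewrite expf_neq0// gt_eqF.
Qed.

(** Preimages of null sets are null. This carries symmetry and ellipticity from $A_1$ to
    $A_\varepsilon$. *)
Lemma ae_affine (a b c : R) (P : plane R -> Prop) : 0 < a ->
  (\forall x \ae leb2 R, P x) -> \forall x \ae leb2 R, P (affine_map a b c x).
Proof.
move=> a0 [N [mN N0 PN]]; exists (affine_map a b c @^-1` N); split.
- rewrite -[X in measurable X]setTI; exact: measurable_affine_map.
- by rewrite leb2_affine// [X in (_ * X)%E]N0 mule0.
- by move=> x /= nP; apply: PN.
Qed.

End affine_maps.

(** * Borel measurability of continuous functions on the plane *)

Section continuous_plane.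
Context (R : realType).

(** The sigma-algebra of [plane R] is the product one, so an open set is written as a countable
    union of squares with rational centre and radius. *)
Lemma open_measurable_plane (U : set (plane R)) : open U -> measurable U.
Proof.
move=> oU.
pose B (t : rat * rat * rat) : set (plane R) :=
  ball (ratr t.1.1 : R) (ratr t.2) `*` ball (ratr t.1.2 : R) (ratr t.2).
have -> : U = \bigcup_(t in [set t | B t `<=` U]) B t.
  apply/seteqP; split; last by move=> x [t /= tU] /tU.
  move=> x Ux; have /nbhs_ballP[e /= e0 eU] := open_nbhs_nbhs (conj oU Ux).
  (* With a radius below $e/2$, a square whose rational centre is closer to [x] than that radius
     stays within distance $e$ of [x]. *)
  have e20 : 0 < e / 2 by rewrite divr_gt0.
  have [r /andP[r0 re]] : exists q : rat, (0 < (ratr q : R) < e / 2).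
    have [q] := rat_in_itvoo e20; rewrite in_itv/= => qq.
    by exists q.
  have near (y : R) : exists q : rat, `|ratr q - y| < ratr r.
    have [q] := @rat_in_itvoo R (y - ratr r) (y + ratr r) ltac:(lra).
    rewrite in_itv/= => qq; exists q; rewrite ltr_distl//.
  have [q1 Hq1] := near x.1; have [q2 Hq2] := near x.2.
  exists (q1, q2, r) => //= y [/= By1 By2]; apply: eU; split => /=.
    move: By1; rewrite -!ball_normE/= => By1.
    rewrite (_ : x.1 - y.1 = (x.1 - ratr q1) + (ratr q1 - y.1)); last by ring.
    by rewrite (le_lt_trans (ler_normD _ _))// distrC; lra.
  move: By2; rewrite -!ball_normE/= => By2.
  rewrite (_ : x.2 - y.2 = (x.2 - ratr q2) + (ratr q2 - y.2)); last by ring.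
  by rewrite (le_lt_trans (ler_normD _ _))// distrC; lra.
rewrite bigcup_mkcond; apply: countable_bigcupT_measurable => // t.
by case: ifPn => // _; apply: measurableX; exact: measurable_ball.
Qed.

Lemma continuous_measurable_plane (f : plane R -> R) :
  continuous f -> measurable_fun setT f.
Proof.
move=> /continuousP cf; apply: (measurability _ (RGenOpens.measurableE R)).
move=> _ [_ [a [b ->] <-]]; rewrite setTI.
by apply: open_measurable_plane; apply/cf/interval_open.
Qed.

End continuous_plane.

(** * Real-valued integrability: domination and comparison almost everywhere *)

Section real_integrable.
Context d (T : measurableType d) (R : realType).
Variables (mu : {measure set T -> \bar R}) (D : set T).
Hypothesis mD : measurable D.
Implicit Types (f g : T -> R) (a M : R).

Definition rintegrable (f : T -> R) := mu.-integrable D (EFin \o f).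

Lemma rintegrable_measurable f : rintegrable f -> measurable_fun D f.
Proof. by move=> /measurable_int/measurable_EFinP. Qed.

Lemma rintegrableD f g :
  rintegrable f -> rintegrable g -> rintegrable (fun x => f x + g x).
Proof. by move=> If Ig; have := integrableD mD If Ig. Qed.

Lemma rintegrableZ a f : rintegrable f -> rintegrable (fun x => a * f x).
Proof. by move=> If; have := integrableZl mD a If. Qed.

Lemma rintegrable_sum (I : Type) (s : seq I) (f : I -> T -> R) :
  (forall i, rintegrable (f i)) -> rintegrable (fun x => \sum_(i <- s) f i x).
Proof.
move=> If; have := @integrable_sum _ _ _ mu _ mD I s xpredT (fun i => EFin \o f i).
move=> /(_ (fun i _ => If i)); rewrite /rintegrable.
by congr (_.-integrable _ _); apply/funext => x /=; rewrite sumEFin.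
Qed.

Lemma rintegrable_ae_le f g : measurable_fun D f ->
  (\forall x \ae mu, D x -> `|f x| <= g x) -> rintegrable g -> rintegrable f.
Proof.
move=> mf fg /integrableP[mg goo]; apply/integrableP; split.
  exact/measurable_EFinP.
apply: le_lt_trans goo; apply: ae_ge0_le_integral => //.
- by apply: measurableT_comp => //; exact/measurable_EFinP.
- exact: measurableT_comp.
- by apply: filterS fg => x fg Dx; rewrite lee_fin (le_trans (fg Dx))// ler_norm.
Qed.

Lemma rintegrable_le f g : measurable_fun D f ->
  (forall x, D x -> `|f x| <= g x) -> rintegrable g -> rintegrable f.
Proof. by move=> mf fg; apply: rintegrable_ae_le => //; exact: aeW. Qed.

Lemma rintegrable_norm f : rintegrable f -> rintegrable (fun x => `|f x|).
Proof. by move=> If; have := integrable_norm If. Qed.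

Lemma rintegrable_cst a : (mu D < +oo)%E -> rintegrable (fun=> a).
Proof.
move=> Dfin; apply/integrableP; split; first exact: measurable_cst.
by rewrite [ltLHS](integral_cst mu mD `|a|%:E)//= lte_mul_pinfty.
Qed.

Lemma rintegrable_mul_bounded f g M : rintegrable f -> measurable_fun D g ->
  (forall x, D x -> `|g x| <= M) -> rintegrable (fun x => f x * g x).
Proof.
move=> If mg gM; apply: (@rintegrable_le _ (fun x => M * `|f x|)).
- by apply: measurable_funM => //; exact: rintegrable_measurable.
- by move=> x Dx; rewrite normrM mulrC ler_wpM2r// gM.
- by apply: rintegrableZ; exact: rintegrable_norm.
Qed.

(** Domination by $1+f^2$, since $|y|\le 1+y^2$; finite measure makes the constant integrable. *)
Lemma sqr_rintegrable f : (mu D < +oo)%E -> measurable_fun D f ->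
  rintegrable (fun x => f x ^+ 2) -> rintegrable f.
Proof.
move=> Dfin mf If2; apply: (@rintegrable_le _ (fun x => 1 + f x ^+ 2)) => //.
  move=> x _; rewrite -real_normK ?num_real//; move: `|f x| => y; nra.
by apply: rintegrableD => //; exact: rintegrable_cst.
Qed.

(** Reduction to pointwise monotonicity: [g] is replaced by $\max(f,g)$, which equals [g] almost
    everywhere on [D] and lies above [f] everywhere. *)
Lemma ae_le_Rintegral f g : rintegrable f -> rintegrable g ->
  (\forall x \ae mu, D x -> f x <= g x) ->
  \int[mu]_(x in D) f x <= \int[mu]_(x in D) g x.
Proof.
move=> If Ig fg.
have Im : rintegrable (fun x => Num.max (f x) (g x)).
  apply: (@rintegrable_le _ (fun x => `|f x| + `|g x|)).
  - apply: measurable_maxr; exact: rintegrable_measurable.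
  - move=> x _; rewrite /Num.max; case: ifP => _; [rewrite lerDr|rewrite lerDl];
      exact: normr_ge0.
  - by apply: rintegrableD; exact: rintegrable_norm.
have -> : \int[mu]_(x in D) g x = \int[mu]_(x in D) Num.max (f x) (g x).
  congr fine; apply: ae_eq_integral => //.
  - exact: (measurable_int mu).
  - exact: (measurable_int mu).
  - by apply: filterS fg => x fg Dx; rewrite /= max_r// fg.
by apply: le_Rintegral => // x _; rewrite le_max lexx.
Qed.

Lemma ae_eq_Rintegral f g : measurable_fun D f -> measurable_fun D g ->
  (\forall x \ae mu, D x -> f x = g x) ->
  \int[mu]_(x in D) f x = \int[mu]_(x in D) g x.
Proof.
move=> mf mg fg; congr fine; apply: ae_eq_integral => //.
- exact/measurable_EFinP.
- exact/measurable_EFinP.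
- by apply: filterS fg => x fg Dx; rewrite fg.
Qed.

End real_integrable.

(** * Periodic functions: from the unit square to bounded boxes *)

Section periodic_integrable.
Context (R : realType).
Local Notation mu := (leb2 R).

Definition rect (a b c e : R) : set (plane R) :=
  [set x | a <= x.1 <= b /\ c <= x.2 <= e].

Lemma rectE a b c e : rect a b c e =
  (`[a, b]%classic : set (measurableTypeR R)) `*`
  (`[c, e]%classic : set (measurableTypeR R)).
Proof. by apply/seteqP; split => x; rewrite /rect /= !in_itv. Qed.

Lemma measurable_rect a b c e : measurable (rect a b c e).
Proof. by rewrite rectE; apply: measurableX; exact: measurable_itv. Qed.

Lemma leb2_rect a b c e : a <= b -> c <= e ->
  leb2 R (rect a b c e) = ((b - a) * (e - c))%:E.
Proof.
move=> ab ce; rewrite rectE leb2X; [|exact: measurable_itv..].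
have L (x y : R) : x <= y ->
    @lebesgue_measure R (`[x, y]%classic : set (measurableTypeR R)) = (y - x)%:E.
  move=> xy; rewrite lebesgue_measure_itv/= lte_fin; case: ltP => // yx.
  by rewrite (@le_anti _ _ x y) ?subrr// xy yx.
by rewrite [X in (X * _)%E](L a b ab) [X in (_ * X)%E](L c e ce).
Qed.

Definition box (K : nat) : set (plane R) := rect (- K%:R) K%:R (- K%:R) K%:R.

Lemma rect_box a b c e : exists K, rect a b c e `<=` box K.
Proof.
pose M := `|a| + `|b| + `|c| + `|e|.
exists (Num.truncn M).+1 => x [/andP[ax xb] /andP[cx xe]].
have MK : M <= (Num.truncn M).+1%:R by exact/ltW/truncnS_gt.
have := ler_norm a; have := ler_norm b; have := ler_norm c; have := ler_norm e.
have := ler_norm (- a); have := ler_norm (- b); have := ler_norm (- c);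
  have := ler_norm (- e).
rewrite !normrN => na nb nc ne pa pb pc pe.
have := normr_ge0 a; have := normr_ge0 b; have := normr_ge0 c; have := normr_ge0 e.
rewrite /M in MK => ? ? ? ?.
by split; apply/andP; split; lra.
Qed.

Lemma OmegaE : @Omega R = rect 0 1 0 1. Proof. by []. Qed.

Lemma measurable_Omega : measurable (@Omega R).
Proof. exact: measurable_rect. Qed.

Lemma leb2_Omega : leb2 R (@Omega R) = 1%E.
Proof. by rewrite OmegaE leb2_rect// subr0 mulr1. Qed.

Lemma measurable_box K : measurable (box K).
Proof. exact: measurable_rect. Qed.

Lemma leb2_box_lty K : (leb2 R (box K) < +oo)%E.
Proof. by rewrite leb2_rect ?ltry// (le_trans _ (ler0n R K))// oppr_le0. Qed.

Lemma translateE m : (fun x : plane R => translate x m) = affine_map 1 m.1%:~R m.2%:~R.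
Proof. by apply/funext => x; rewrite /translate /affine_map !mul1r. Qed.

Lemma measurable_translate m :
  measurable_fun setT (fun x : plane R => translate x m).
Proof. by rewrite translateE; exact: measurable_affine_map. Qed.

Lemma measurable_translate_preimage m (D : set (plane R)) : measurable D ->
  measurable ((translate (R:=R))^~ m @^-1` D).
Proof. by move=> mD; rewrite -[X in measurable X]setTI;
  apply: measurable_translate. Qed.

(** Translations preserve the measure, so a change of variables together with periodicity turns the
    integral over the shifted set into the one over [D]. *)
Lemma rintegrable_translate (f : plane R -> R) (D : set (plane R)) m :
  measurable_fun setT f -> Zperiodic f -> measurable D -> rintegrable mu D f ->
  rintegrable mu ((translate (R:=R))^~ m @^-1` D) f.
Proof.
move=> mf pf mD /integrableP[_ fi]; apply/integrableP; split.
  exact/measurable_EFinP/measurable_funTS.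
pose nu_ : {measure set (plane R) -> \bar R} :=
  pushforward (leb2 R) (affine_map 1 m.1%:~R m.2%:~R).
pose nu := nu_ (measurable_affine_map 1 m.1%:~R m.2%:~R).
move: fi; rewrite (eq_measure_integral nu); last first.
  move=> A mA _; rewrite /nu /= /pushforward.
  by rewrite leb2_affine// expr1n invr1 mul1e.
rewrite ge0_integral_pushforward//; last 2 first.
- exact: measurable_affine_map.
- by do 2 apply: measurableT_comp => //; exact: measurable_funTS.
rewrite -translateE; apply: le_lt_trans; rewrite le_eqVlt; apply/orP; left; apply/eqP.
by apply: eq_integral => x _ /=; rewrite pf.
Qed.

Definition int_range (K : nat) : seq int := [seq k%:Z - K%:Z | k <- iota 0 (2 * K).+1].

Lemma mem_int_range K (k : int) : (k \in int_range K) = (`|k| <= K)%N.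
Proof.
apply/mapP/idP => [[i]|kK].
  by rewrite mem_iota add0n => /andP[_ iK] ->; lia.
exists (absz (k + K%:Z)); last by lia.
by rewrite mem_iota; lia.
Qed.

Lemma int_range_uniq K : uniq (int_range K).
Proof. by rewrite map_inj_uniq ?iota_uniq// => i j; lia. Qed.

Definition int_pairs (K : nat) : seq (int * int) :=
  [seq (i, j) | i <- int_range K, j <- int_range K].

Lemma mem_int_pairs K m : (m \in int_pairs K) = (`|m.1| <= K)%N && (`|m.2| <= K)%N.
Proof.
case: m => i j; rewrite -!mem_int_range; apply/allpairsP/andP => /=.
  by move=> [[a b] /= [? ? [-> ->]]].
by move=> [iK jK]; exists (i, j).
Qed.

Lemma int_pairs_uniq K : uniq (int_pairs K).
Proof. by apply: allpairs_uniq; rewrite ?int_range_uniq// => -[? ?] [? ?] _ _ /= [-> ->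
  ]. Qed.

Lemma floor_bound (x : R) (K : nat) : `|x| <= K%:R -> (`|Num.floor x| <= K)%N.
Proof.
rewrite ler_norml => /andP[Kx xK].
have : (Num.floor x <= K%:Z)%R.
  by rewrite -(ler_int R) (le_trans (floor_le x)).
have : (- K%:Z <= Num.floor x)%R.
  by rewrite floor_ge_int mulrNz.
by lia.
Qed.

Lemma box_norm K (x : plane R) : box K x <-> `|x.1| <= K%:R /\ `|x.2| <= K%:R.
Proof. by rewrite !ler_norml. Qed.

(** The shift is by minus the floors of the coordinates. For [x] in [box K] these are at most [K] in
    absolute value, so finitely many shifts serve the whole box. *)
Lemma translate_floor (x : plane R) : exists2 m : int * int,
  Omega (translate x m) & forall K, box K x -> m \in int_pairs K.
Proof.
exists (- Num.floor x.1, - Num.floor x.2).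
  rewrite /Omega /translate /= !mulrNz !subr_ge0 !floor_le !lerBlDr ![1 + _]addrC.
  have := floorD1_gt x.1; have := floorD1_gt x.2.
  by rewrite !intrD => /ltW -> /ltW ->.
move=> K /box_norm[/floor_bound x1 /floor_bound x2].
by rewrite mem_int_pairs /= !abszN x1.
Qed.

(** Finitely many translates of [Omega] cover the box, so there $|f|$ is at most the sum of its
    restrictions to these translates, each integrable by periodicity. *)
Lemma rintegrable_box (f : plane R -> R) K :
  measurable_fun setT f -> Zperiodic f -> rintegrable mu (@Omega R) f ->
  rintegrable mu (box K) f.
Proof.
move=> mf pf fi.
pose D m := (translate (R:=R))^~ m @^-1` @Omega R.
have mD m : measurable (D m).
  exact: measurable_translate_preimage measurable_Omega.
have Dfi m : rintegrable mu setT ((fun x => `|f x|) \_ (D m)).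
  rewrite /rintegrable -restrict_EFin; apply/(integrable_mkcond _ (mD m)).
  by apply: rintegrable_norm; apply: rintegrable_translate => //;
    exact: measurable_Omega.
have S := rintegrable_sum measurableT (int_pairs K) Dfi.
apply: (rintegrable_le (measurable_box K) _ _
  (integrableS measurableT (measurable_box K) (@subsetT _ _) S)).
  exact: measurable_funTS.
move=> x /= xK; have [m Om /(_ _ xK) mK] := translate_floor x.
rewrite (big_rem m mK)/= patchE mem_set//= lerDl sumr_ge0// => i _.
by rewrite patchE; case: ifP.
Qed.

End periodic_integrable.

(** * Products of periodic functions with compactly supported ones *)

Section test_functions.
Context (R : realType).
Local Notation mu := (leb2 R).

Lemma plane_norm_le (x : plane R) (M : R) : `|x| <= M -> `|x.1| <= M /\ `|x.2| <= M.
Proof. by rewrite prod_normE ge_max => /andP[]. Qed.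

Lemma compact_box (S : set (plane R)) : compact S -> exists K : nat, S `<=` @box R K.
Proof.
move=> /compact_bounded[M [_ /(_ (M + 1))]]; rewrite ltrDl => /(_ ltr01) SM.
exists (Num.truncn (`|M + 1|)).+1 => x /SM /= /plane_norm_le xM.
have H : M + 1 <= (Num.truncn (`|M + 1|)).+1%:R.
  by rewrite (le_trans (ler_norm _))// ltW// truncnS_gt.
by case: xM => x1 x2; apply/box_norm; split; exact: le_trans H.
Qed.

Lemma continuous_compact_support_bounded (g : plane R -> R) (S : set (plane R)) :
  continuous g -> compact S -> (forall x, ~ S x -> g x = 0) ->
  exists M : R, forall x, `|g x| <= M.
Proof.
move=> cg cS g0.
have /compact_bounded[M [_ gSM]] : compact (g @` S).
  by apply: continuous_compact => //; exact: continuous_subspaceT.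
have /gSM SM : M < `|M| + 1 by rewrite (le_lt_trans (ler_norm M))// ltrDl.
exists (`|M| + 1) => x; have [Sx|nSx] := pselect (S x); first by apply: SM; exists x.
by rewrite g0// normr0 addr_ge0.
Qed.

(** The complement of the closed support is open, so [phi] vanishes on a neighbourhood of [x]. *)
Lemma derive_off_support (phi : plane R -> R) (v x : plane R) :
  ~ closure [set y | phi y != 0] x -> 'D_v phi x = 0.
Proof.
move=> nx; have [->|v0] := eqVneq v 0; first exact: derive0.
rewrite (@near_eq_derive _ _ _ _ (cst 0)) ?derive_cst//.
have : open (~` closure [set y | phi y != 0]).
  by rewrite openC; exact: closed_closure.
rewrite openE => /(_ x nx); apply: filterS => y ny.
apply/eqP/negPn/negP => py; apply: ny; exact: subset_closure.
Qed.

(** Both integrals in the weak derivative identity have this form. On a box containing [S], [u] is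
    square integrable by periodicity, hence integrable, and [g] is bounded; outside the box the
    product vanishes. *)
Lemma rintegrable_mul_compact (u g : plane R -> R) (S : set (plane R)) :
  measurable_fun setT u -> Zperiodic u ->
  rintegrable mu (@Omega R) (fun x => u x ^+ 2) ->
  continuous g -> compact S -> (forall x, ~ S x -> g x = 0) ->
  rintegrable mu setT (fun x => u x * g x).
Proof.
move=> um up u2 cg cS g0.
have [K SK] := compact_box cS.
have [M gM] := continuous_compact_support_bounded cg cS g0.
have mg := continuous_measurable_plane cg.
have mK := @measurable_box R K.
have u2K : rintegrable mu (@box R K) (fun x => u x ^+ 2).
  apply: rintegrable_box => //; first exact: measurable_funX.
  by move=> x m; rewrite up.
have uK : rintegrable mu (@box R K) u.
  by apply: sqr_rintegrable => //; [exact: leb2_box_lty|exact: measurable_funTS].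
have ugK : rintegrable mu (@box R K) (fun x => u x * g x).
  by apply: (@rintegrable_mul_bounded _ _ _ _ _ mK _ _ M) => //;
    exact: measurable_funTS.
move: ugK => /(integrable_mkcond _ mK); rewrite restrict_EFin /rintegrable.
congr (_.-integrable _ (EFin \o _)); apply/funext => x; rewrite patchE.
case: ifPn => // /negP xK; rewrite g0 ?mulr0// => Sx; apply: xK.
by apply: mem_set; exact: SK.
Qed.

End test_functions.

(** * Linear combinations in the periodic Sobolev space *)

Section H1per_space.
Context (R : realType).
Local Notation mu := (leb2 R).
Implicit Types (u v : jet R) (a : R).

Lemma Rintegral_lin d (T : measurableType d) (nu : {measure set T -> \bar R})
    (D : set T) (mD : measurable D) a (f g : T -> R) :
  rintegrable nu D f -> rintegrable nu D g ->
  \int[nu]_(x in D) (a * f x + g x) =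
  a * \int[nu]_(x in D) f x + \int[nu]_(x in D) g x.
Proof.
move=> If Ig; rewrite RintegralD// ?RintegralZl//.
exact: rintegrableZ.
Qed.

(** The bound $2a^2f^2+2g^2$ exceeds the square by $(af-g)^2$. *)
Lemma rintegrable_sqr_lin d (T : measurableType d) (nu : {measure set T -> \bar R})
    (D : set T) (mD : measurable D) a (f g : T -> R) :
  measurable_fun D f -> measurable_fun D g ->
  rintegrable nu D (fun x => f x ^+ 2) -> rintegrable nu D (fun x => g x ^+ 2) ->
  rintegrable nu D (fun x => (a * f x + g x) ^+ 2).
Proof.
move=> mf mg If Ig.
apply: (@rintegrable_le _ _ _ _ _ mD _ (fun x => 2 * a ^+ 2 * f x ^+ 2 + 2 * g x ^+ 2)).
- by apply: measurable_funX; apply: measurable_funD => //; exact: measurable_funM.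
- move=> x _; rewrite ger0_norm ?sqr_ge0//.
  by rewrite -subr_ge0 [leRHS](_ : _ = (a * f x - g x) ^+ 2) ?sqr_ge0//; ring.
- by apply: rintegrableD => //; exact: rintegrableZ.
Qed.

Lemma jet_lin1 a u v x : (a *: u + v).1 x = a * u.1 x + v.1 x.
Proof. by []. Qed.

Lemma jet_lin2 a u v x k : (a *: u + v).2 x k 0 = a * u.2 x k 0 + v.2 x k 0.
Proof. by rewrite !mxE. Qed.

(** The delicate clause is the weak derivative: splitting its integrals requires each product with
    [phi] or its derivative to be integrable over the plane. *)
Lemma H1per_lin a u v : H1per u -> H1per v -> H1per (a *: u + v).
Proof.
move=> [[mu1 mu2] [pu1 pu2] Iu1 Iu2 Du] [[mv1 mv2] [pv1 pv2] Iv1 Iv2 Dv].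
have E2 k : (fun x => (a *: u + v).2 x k 0) = (fun x => a * u.2 x k 0 + v.2 x k 0).
  by apply/funext => x; rewrite jet_lin2.
split.
- split; first by apply: measurable_funD => //; exact: measurable_funM.
  by move=> k; rewrite E2; apply: measurable_funD => //; exact: measurable_funM.
- split=> x m; first by rewrite !jet_lin1 pu1 pv1.
  by rewrite /= -[LHS]/(a *: u.2 _ + v.2 _) pu2 pv2.
- change (rintegrable mu (@Omega R) (fun x => (a * u.1 x + v.1 x) ^+ 2)).
  apply: (rintegrable_sqr_lin (@measurable_Omega R) _ _ _ Iu1 Iv1);
    exact: measurable_funTS.
- move=> k; suff : rintegrable mu (@Omega R)
      (fun x => (a * u.2 x k 0 + v.2 x k 0) ^+ 2).
    by congr (_.-integrable _ _); apply/funext => x; rewrite /= jet_lin2.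
  apply: (rintegrable_sqr_lin (@measurable_Omega R) _ _ _ (Iu2 k) (Iv2 k));
    exact: measurable_funTS.
- move=> phi k tphi; have [Cphi Sphi _] := tphi.
  (* First-order regularity supplies the continuity of [phi] and of its partial derivative. *)
  have [cphi /(_ k)[_ cD]] := Cphi 1%N.
  have phi0 x : ~ closure [set x | phi x != 0] x -> phi x = 0.
    by move=> nx; apply/eqP/negPn/negP => px; apply: nx; exact: subset_closure.
  have D0 x := @derive_off_support R phi (dir R k) x.
  have I1 (w : jet R) : H1per w ->
    rintegrable mu setT (fun x => w.1 x * 'D_(dir R k) phi x).
    by move=> [[m1 _] [p1 _] i1 _ _]; exact: rintegrable_mul_compact D0.
  have I2 (w : jet R) : H1per w -> rintegrable mu setT (fun x => w.2 x k 0 * phi x).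
    move=> [[_ m2] [_ p2] _ i2 _].
    apply: (rintegrable_mul_compact (m2 k) _ (i2 k) cphi Sphi phi0).
    by move=> x m; rewrite p2.
  transitivity (\int[mu]_x
      (a * (u.1 x * 'D_(dir R k) phi x) + v.1 x * 'D_(dir R k) phi x)).
    by apply: eq_Rintegral => x _; rewrite jet_lin1 mulrDl mulrA.
  rewrite Rintegral_lin//; [|exact: I1..].
  rewrite Du// Dv// mulrN -opprD; congr (- _).
  rewrite -Rintegral_lin//; [|exact: I2..].
  by apply: eq_Rintegral => x _; rewrite jet_lin2 mulrDl mulrA.
Qed.

End H1per_space.

(** * The quasi-interpolation $I_H$ and its kernel $W$ *)

Section quasi_interpolation.
Context (R : realType).
Local Notation mu := (leb2 R).
Implicit Types (u v w : plane R -> R) (p q : plane R -> R) (T : set (plane R)).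

Lemma measurable_affine p : affine p -> measurable_fun setT p.
Proof.
move=> [c0 [c1 [c2 pE]]].
have -> : p = (fun x => c0 + c1 * x.1 + c2 * x.2) by apply/funext => x; rewrite pE.
apply: measurable_funD; last exact: measurable_funM.
by apply: measurable_funD => //; exact: measurable_funM.
Qed.

Lemma affine_cst (c : R) : affine (fun=> c : R).
Proof. by exists c, 0, 0 => x; rewrite !mul0r !addr0. Qed.

Lemma affine_lin a p q : affine p -> affine q -> affine (fun x => a * p x + q x).
Proof.
move=> [c0 [c1 [c2 pE]]] [e0 [e1 [e2 qE]]].
exists (a * c0 + e0), (a * c1 + e1), (a * c2 + e2) => x; rewrite pE qE; ring.
Qed.

Lemma affine_box_bounded p K : affine p -> exists M, forall x, box K x -> `|p x| <= M.
Proof.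
move=> [c0 [c1 [c2 pE]]]; exists (`|c0| + `|c1| * K%:R + `|c2| * K%:R).
move=> x /box_norm[x1 x2]; rewrite pE.
rewrite (le_trans (ler_normD _ _))// lerD//; last by rewrite normrM ler_wpM2l.
by rewrite (le_trans (ler_normD _ _))// lerD// normrM ler_wpM2l.
Qed.

Lemma squareE H s : square H s =
  rect (s.1%:~R * H) ((s.1 + 1)%:~R * H)
    (s.2%:~R * H) ((s.2 + 1)%:~R * H) :> set (plane R).
Proof. by []. Qed.

Lemma measurable_triangle d (H : R) t : measurable (triangle d H t).
Proof.
pose g (x : plane R) := let a := x.1 - t.1.1%:~R * H in
    let b := x.2 - t.1.2%:~R * H in if d then a + b - H else b - a.
have mg : measurable_fun setT g.
  apply: measurable_affine; rewrite /g; case: (d).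
    exists (- t.1.1%:~R * H - t.1.2%:~R * H - H), 1, 1 => x /=; ring.
  exists (- t.1.2%:~R * H + t.1.1%:~R * H), (- 1), 1 => x /=; ring.
have -> : triangle d H t = square H t.1 `&`
    g @^-1` (if t.2 then `[0, +oo[%classic else `]-oo, 0]%classic).
  apply/seteqP; split => x; rewrite /triangle /= -/(g x); case: (t.2);
    by rewrite /= in_itv/= ?andbT.
apply: measurableI; first exact: measurable_rect.
rewrite -[X in measurable X]setTI; apply: mg => //.
by case: (t.2); exact: measurable_itv.
Qed.

Lemma triangle_box d (H : R) t : exists K, triangle d H t `<=` box K.
Proof.
have [K sK] := rect_box (t.1.1%:~R * H) ((t.1.1 + 1)%:~R * H)
  (t.1.2%:~R * H) ((t.1.2 + 1)%:~R * H).
by exists K => x [xs _]; exact: sK.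
Qed.

(** Enough for the local projections in $I_H$: every triangle lies in a box, and affine functions
    are bounded there. *)
Definition locally_integrable u := forall K, rintegrable mu (@box R K) u.

Lemma H1per_locally_integrable (u : jet R) : H1per u -> locally_integrable u.1.
Proof.
move=> [[mu1 _] [pu1 _] Iu1 _ _] K; have mK := @measurable_box R K.
apply: sqr_rintegrable => //; [exact: leb2_box_lty|exact: measurable_funTS|].
apply: rintegrable_box => //; first exact: measurable_funX.
by move=> x m; rewrite pu1.
Qed.

Lemma rintegrable_triangle d (H : R) t u q : locally_integrable u -> affine q ->
  rintegrable mu (triangle d H t) (fun x => u x * q x).
Proof.
move=> lu aq; have [K tK] := triangle_box d H t; have mK := @measurable_box R K.
have [M qM] := affine_box_bounded K aq.
apply: (integrableS mK (measurable_triangle d H t) tK).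
apply: (@rintegrable_mul_bounded _ _ _ _ _ mK _ _ M) => //.
by apply: measurable_funTS; exact: measurable_affine.
Qed.

Lemma locally_integrable_lin a u v :
  locally_integrable u -> locally_integrable v ->
  locally_integrable (fun x => a * u x + v x).
Proof.
move=> lu lv K; have mK := @measurable_box R K.
by apply: rintegrableD => //; exact: rintegrableZ.
Qed.

Lemma affine_locally_integrable p : affine p -> locally_integrable p.
Proof.
move=> ap K; have mK := @measurable_box R K; have [M pM] := affine_box_bounded K ap.
apply: (@rintegrable_le _ _ _ _ _ mK _ (fun=> M)) => //.
  by apply: measurable_funTS; exact: measurable_affine.
by apply: rintegrable_cst => //; exact: leb2_box_lty.
Qed.

(** The residual of the combination is the same combination of the residuals; local integrability
    allows the orthogonality integral to be split. *)
Lemma L2proj_lin d (H : R) t a u v p q :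
  locally_integrable u -> locally_integrable v ->
  L2proj (triangle d H t) u p -> L2proj (triangle d H t) v q ->
  L2proj (triangle d H t) (fun x => a * u x + v x) (fun x => a * p x + q x).
Proof.
move=> lu lv [ap up] [aq vq]; split; first exact: affine_lin.
move=> r ar.
transitivity (\int[mu]_(x in triangle d H t)
    (a * ((u x - p x) * r x) + (v x - q x) * r x)).
  by apply: eq_Rintegral => x _; ring.
have I w s : locally_integrable w -> affine s ->
    rintegrable mu (triangle d H t) (fun x => (w x - s x) * r x).
  move=> lw /affine_locally_integrable ls.
  have := locally_integrable_lin (- 1) ls lw => lws.
  have := @rintegrable_triangle d H t _ _ lws ar.
  by congr (_.-integrable _ _); apply/funext => x /=; congr EFin; ring.
rewrite Rintegral_lin//; [|exact: measurable_triangle|exact: I..].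
by rewrite up// vq// mulr0 addr0.
Qed.

(** A square containing the node has its lower left corner at most one step away in each direction.
    Finiteness gives [fset_set] and the sum in [is_IH] their intended values. *)
Lemma triangles_at_finite d (H : R) z : 0 < H -> finite_set (triangles_at d H z).
Proof.
move=> H0.
apply: (@sub_finite_set _ _ [set` [seq ((z.1 + m.1, z.2 + m.2), b) |
  m <- int_pairs 1, b <- [:: true; false]]]); last exact: finite_seq.
move=> [s b] [zs _]; apply/allpairsP.
move: zs; rewrite /square /node /= !(ler_pM2r H0) !ler_int => -[s1 s2].
exists ((s.1 - z.1, s.2 - z.2), b); split => /=.
- by rewrite mem_int_pairs /=; lia.
- by case: b; rewrite !inE.
- by case: s {s1 s2} => s1 s2 /=; rewrite ![_ + (_ - _)]addrC !subrK.
Qed.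

(** Makes the number of triangles at a node nonzero, so that the nodal average is a genuine mean. *)
Lemma triangles_at_own d (H : R) z : 0 < H -> triangles_at d H z (z, false).
Proof.
move=> H0; split => /=; last by case: d; rewrite /node /=; lra.
by rewrite /square /node /= !lexx !(ler_pM2r H0) !ler_int !lerDl.
Qed.

Lemma is_IH_cst_lin d (H : R) a u v (c e : R) : 0 < H ->
  locally_integrable u -> locally_integrable v ->
  is_IH d H u (fun=> c) -> is_IH d H v (fun=> e) ->
  is_IH d H (fun x => a * u x + v x) (fun=> a * c + e).
Proof.
move=> H0 lu lv [_ [p up pn]] [_ [q vq qn]]; split.
  split=> [|//|t]; first exact: cst_continuous.
  by exists (fun=> a * c + e) => //; exact: affine_cst.
exists (fun t x => a * p t x + q t x) => [t|z]; first exact: L2proj_lin.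
have fin := triangles_at_finite d z H0.
move: (pn z) (qn z); rewrite !fsbig_finite//= => -> ->.
by rewrite big_split/= -big_distrr/= mulrDr mulrCA.
Qed.

Lemma inW_lin d (H : R) a (u v : jet R) : 0 < H ->
  inW d H u -> inW d H v -> inW d H (a *: u + v).
Proof.
move=> H0 [hu [c uc]] [hv [e ve]]; split; first exact: H1per_lin.
exists (a * c + e).
have lu := H1per_locally_integrable hu; have lv := H1per_locally_integrable hv.
by have := is_IH_cst_lin a H0 lu lv uc ve.
Qed.

Lemma inW_sum d (H : R) (I : Type) (s : seq I) (w : I -> jet R) (w0 : jet R) : 0 < H ->
  inW d H w0 -> (forall i, inW d H (w i)) -> inW d H (\sum_(i <- s) w i).
Proof.
move=> H0 h0 hw; elim/big_ind: _ => [|u v hu hv|i _]; last exact: hw.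
(* The empty sum is written as [- w0 + w0]; [w0] is supplied for this purpose. *)
- by rewrite -(addNr w0) -scaleN1r; exact: inW_lin.
- by rewrite -[u]scale1r; exact: inW_lin.
Qed.

Lemma omega_box (H : R) z : 0 < H -> exists K, omega H z `<=` @box R K.
Proof.
move=> H0; have [K sK] := rect_box ((z.1 - 1)%:~R * H) ((z.1 + 1)%:~R * H)
  ((z.2 - 1)%:~R * H) ((z.2 + 1)%:~R * H).
exists K => x [s [c1 c2] [/andP[x1 x1'] /andP[x2 x2']]]; apply: sK.
by split; apply/andP; split;
  ((apply: le_trans x1 || apply: le_trans x2 ||
    apply: (le_trans x1') || apply: (le_trans x2'));
   rewrite (ler_pM2r H0) ler_int; lia).
Qed.

(** If [x] lies in [box n] and its translate in [box K], the shift is at most $n+K$ in each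
    coordinate. On each box the lattice sum is therefore a fixed finite sum. *)
Lemma measurable_periodize (f : plane R -> R) K n : measurable_fun setT f ->
  (forall x, ~ box K x -> f x = 0) -> measurable_fun (@box R n) (periodize f).
Proof.
move=> mf f0; pose s := int_pairs (n + K).
apply: (@eq_measurable_fun _ _ _ _ _ (fun x => \sum_(m <- s) f (translate x m))).
  move=> x /set_mem /box_norm[x1 x2]; rewrite /periodize (@fsbigE _ _ _ _ _ s)//=.
  - by apply: eq_bigl => m; rewrite in_setT.
  - exact: int_pairs_uniq.
  - move=> m _; apply: contraNeq => fm;
      have /box_norm[/= y1 y2] : box K (translate x m).
      by apply: contrapT => /f0 f0m; rewrite f0m eqxx in fm.
    have bd (a : R) (k : int) : `|a| <= n%:R -> `|a + k%:~R| <= K%:R ->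
      (`|k| <= n + K)%N.
      move=> an akK; rewrite -(ler_nat R) natr_absz intr_norm natrD.
      rewrite (_ : k%:~R = (a + k%:~R) - a); last by ring.
      by rewrite (le_trans (ler_normB _ _))// addrC lerD.
    by rewrite mem_int_pairs (bd x.1)// (bd x.2).
apply: measurable_funTS; apply: measurable_sum => m.
apply: (measurableT_comp mf (measurable_translate m)).
Qed.

(** The representation of [w] holds only almost everywhere, which suffices because $I_H$ sees a
    function through integrals over triangles. *)
Lemma inWz_inW d (H : R) z (w : jet R) : 0 < H -> inWz d H z w -> inW d H w.
Proof.
move=> H0 [hw [v [p [c [[[mv _] v0 _] [[cp pp pa] [q qP qn]] wE]]]]]; split => //.
exists c; split.
  split=> [|//|t]; first exact: cst_continuous.
  by exists (fun=> c) => //; exact: affine_cst.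
have /choice[r rP] : forall t, exists r, affine r /\ {in triangle d H t, p =1 r}.
  by move=> t; have [r ? ?] := pa t; exists r.
(* Here $q_t$ projects the periodized [v] on [t], and $r_t$ is the affine function that agrees with
   [p] on [t]. *)
exists (fun t x => q t x - r t x + c) => [t|y].
  have [aq wq] := qP t; have [ar pr] := rP t; split.
    have := affine_lin 1 (affine_lin (- 1) ar aq) (affine_cst c).
    by congr affine; apply/funext => x; ring.
  (* Since $p=r_t$ on [t], the residual of [w] equals that of the periodized [v] almost everywhere
     on [t]. *)
  move=> s sa; rewrite -[RHS](wq _ sa).
  have [K tK] := triangle_box d H t.
  have [n oK] := omega_box z H0.
  have mt := measurable_triangle d H t.
  have aff_t (g : plane R -> R) : affine g -> measurable_fun (triangle d H t) g.
    by move=> /measurable_affine; exact: measurable_funTS.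
  apply: ae_eq_Rintegral => //.
  - apply: measurable_funM; last exact: aff_t.
    apply: measurable_funB; first by case: hw => -[/measurable_funTS].
    apply: measurable_funD => //; apply: measurable_funB; exact: aff_t.
  - apply: measurable_funM; last exact: aff_t.
    apply: measurable_funB; last exact: aff_t.
    apply: (@measurable_funS _ _ _ _ (box K)) => //; first exact: measurable_box.
    apply: (@measurable_periodize _ n) => // x nx.
    by have [] := v0 x (fun ox => nx (oK _ ox)).
  - apply: filterS wE => x wE xt.
    rewrite wE; have -> : p x = r t x by apply: pr; exact: mem_set.
    ring.
have fin := triangles_at_finite d y H0.
(* Every $r_t$ with [t] at the node takes the value of [p] there, and the $q_t$ average to that same
   value; the mean is thus $p+(c-p)=c$. *)
rewrite (eq_fsbigr (fun t => q t (node H y) + (c - p (node H y)))); last first.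
  move=> t /set_mem yt; have [_ pr] := rP t.
  have -> : p (node H y) = r t (node H y) by apply: pr; exact: mem_set.
  ring.
have n0 : (#|` fset_set (triangles_at d H y)|%fset)%:R != 0 :> R.
  rewrite pnatr_eq0 cardfs_eq0; apply/fset0Pn; exists (y, false).
  by rewrite in_fset_set//; apply: mem_set; exact: triangles_at_own.
rewrite fsbig_finite//= big_split/= mulrDr -fsbig_finite// -qn.
rewrite big_const_seq count_predT iter_addr_0 -[(_ - _) *+ _]mulr_natl mulKf//.
ring.
Qed.

End quasi_interpolation.

(** * The Euclidean product and a weighted Young inequality *)

Section dot_product.
Context (R : realType).
Implicit Types (x y z : 'cV[R]_2) (M : 'M[R]_2).

Lemma dotE x y : dot x y = \sum_k x k 0 * y k 0.
Proof. by rewrite /dot mxE; apply: eq_bigr => k _; rewrite mxE. Qed.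

Lemma dotC x y : dot x y = dot y x.
Proof. by rewrite !dotE; apply: eq_bigr => k _; rewrite mulrC. Qed.

Lemma dot_linl a x y z : dot (a *: x + y) z = a * dot x z + dot y z.
Proof.
rewrite !dotE mulr_sumr -big_split; apply: eq_bigr => k _ /=.
by rewrite !mxE mulrDl mulrA.
Qed.

Lemma dot_linr a x y z : dot x (a *: y + z) = a * dot x y + dot x z.
Proof. by rewrite !(dotC x) dot_linl. Qed.

Lemma dot_mulmx M x y : dot (M *m x) y = \sum_k \sum_j M k j * x j 0 * y k 0.
Proof. by rewrite dotE; apply: eq_bigr => k _; rewrite mxE mulr_suml. Qed.

Lemma dot_sym M x y : M^T = M -> dot (M *m x) y = dot (M *m y) x.
Proof. by move=> sM; rewrite [RHS]dotC /dot trmx_mul sM mulmxA. Qed.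

Lemma dot_self_ge0 x : 0 <= dot x x.
Proof. by rewrite dotE sumr_ge0// => k _; rewrite -expr2 sqr_ge0. Qed.

Lemma dot_evec (k : 'I_2) : dot (evec R k) (evec R k) = 1.
Proof.
by rewrite dotE (bigD1 k)//= !mxE !eqxx mulr1 big1 ?addr0// => j jk;
  rewrite !mxE (negbTE jk) mul0r.
Qed.

(** The quadratic form is nonnegative at $sx+y$ and at $-sx+y$, which gives the two signs after
    division by $2s$; symmetry merges the mixed terms. *)
Lemma dot_amgm M x y (s : R) : 0 < s -> M^T = M ->
  (forall z, 0 <= dot (M *m z) z) ->
  `|dot (M *m x) y| <= s / 2 * dot (M *m x) x + (2 * s)^-1 * dot (M *m y) y.
Proof.
move=> s0 sM M0.
have P (t : R) : 0 <= t * (t * dot (M *m x) x + dot (M *m x) y) +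
    (t * dot (M *m y) x + dot (M *m y) y).
  by have := M0 (t *: x + y); rewrite mulmxDr -scalemxAr dot_linl !dot_linr.
have := P s; have := P (- s); rewrite (dot_sym y x sM).
set a := dot (M *m x) x; set b := dot (M *m x) y; set c := dot (M *m y) y.
move=> Hm Hp.
rewrite -(@ler_pM2l _ (2 * s)) ?mulr_gt0//.
rewrite (_ : 2 * s * (s / 2 * a + (2 * s)^-1 * c) = s ^+ 2 * a + c); last first.
  by field; rewrite gt_eqF.
rewrite -[2 * s]gtr0_norm ?mulr_gt0// -normrM ler_norml; apply/andP; split; nra.
Qed.

End dot_product.

(** * The energy form and its estimates *)

Section bilinear_form.
Context (R : realType) (alpha beta : R) (A : plane R -> 'M[R]_2).
Local Notation mu := (leb2 R).
Hypothesis alpha0 : 0 < alpha.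
Hypothesis mA : forall k j, measurable_fun setT (fun x => A x k j).
Hypothesis symA : \forall x \ae mu, (A x)^T = A x.
Hypothesis ellA : \forall x \ae mu, forall xi : 'cV[R]_2,
  alpha * dot xi xi <= dot xi (A x *m xi) <= beta * dot xi xi.
Implicit Types (D : set (plane R)) (f g h : plane R -> 'cV[R]_2) (u v w : jet R).

Definition square_integrable D f :=
  forall k, measurable_fun setT (fun x => f x k 0) /\
    rintegrable mu D (fun x => f x k 0 ^+ 2).

Lemma ae_dot_ge0 : \forall x \ae mu, forall z : 'cV[R]_2, 0 <= dot (A x *m z) z.
Proof.
apply: filterS ellA => x ell z; have /andP[+ _] := ell z.
rewrite [dot z (_ *m _)]dotC; apply: le_trans.
by apply: mulr_ge0; [exact: ltW|exact: dot_self_ge0].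
Qed.

Lemma ae_dot_le : \forall x \ae mu,
  forall z : 'cV[R]_2, dot (A x *m z) z <= beta * dot z z.
Proof. by apply: filterS ellA => x ell z; have /andP[_] := ell z; rewrite dotC. Qed.

Lemma measurable_dot f g : (forall k, measurable_fun setT (fun x => f x k 0)) ->
  (forall k, measurable_fun setT (fun x => g x k 0)) ->
  measurable_fun setT (fun x => dot (A x *m f x) (g x)).
Proof.
move=> mf mg; under eq_fun do rewrite dot_mulmx.
apply: measurable_sum => k; apply: measurable_sum => j.
by apply: measurable_funM => //; apply: measurable_funM.
Qed.

Lemma rintegrable_dot_self D f : measurable D -> square_integrable D f ->
  rintegrable mu D (fun x => dot (f x) (f x)).
Proof.
move=> mD If; have := rintegrable_sum mD (index_enum 'I_2) (fun k => (If k).2).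
by congr (_.-integrable _ _); apply/funext => x /=; rewrite dotE.
Qed.

(** Domination by $\frac\beta2(|f|^2+|g|^2)$, from the Young inequality with weight 1 and the upper
    ellipticity bound. *)
Lemma rintegrable_dot D f g : measurable D ->
  square_integrable D f -> square_integrable D g ->
  rintegrable mu D (fun x => dot (A x *m f x) (g x)).
Proof.
move=> mD If Ig.
apply: (@rintegrable_ae_le _ _ _ _ _ mD _ (fun x => (1 / 2 * beta) * dot (f x) (f x) +
    ((2 * 1)^-1 * beta) * dot (g x) (g x))).
- by apply: measurable_funTS; apply: measurable_dot => k;
    [have [] := If k|have [] := Ig k].
- apply: filterS3 symA ae_dot_ge0 ae_dot_le => x sA A0 Ab _.
  rewrite (le_trans (dot_amgm (f x) (g x) ltr01 sA A0))// lerD//;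
    by rewrite -[leRHS]mulrA ler_wpM2l ?mulr1 ?mul1r ?invr_ge0.
- by apply: rintegrableD => //; apply: rintegrableZ => //; exact: rintegrable_dot_self.
Qed.

Lemma square_integrable_cst D (c : 'cV[R]_2) : measurable D -> (mu D < +oo)%E ->
  square_integrable D (fun=> c).
Proof. by move=> mD Dfin k; split=> //; exact: rintegrable_cst. Qed.

Lemma square_integrableS D E f : measurable D -> measurable E -> E `<=` D ->
  square_integrable D f -> square_integrable E f.
Proof.
move=> mD mE ED If k; have [mf fi] := If k; split => //.
exact: integrableS ED fi.
Qed.

Lemma H1per_square_integrable u : H1per u -> square_integrable (@Omega R) u.2.
Proof. by move=> [[_ m2] _ _ I2 _] k; split => //; exact: I2. Qed.

Lemma Rintegral_dot_ge0 D f : measurable D -> square_integrable D f ->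
  0 <= \int[mu]_(x in D) dot (A x *m f x) (f x).
Proof.
(* Zero is written as an integral over [D] so that the almost-everywhere comparison applies;
   positivity of the integrand is known only off a null set. *)
move=> mD If; have -> : 0 = \int[mu]_(x in D) (0 * dot (A x *m f x) (f x)).
  by rewrite RintegralZl ?mul0r//; exact: rintegrable_dot.
apply: ae_le_Rintegral => //.
- by apply: rintegrableZ => //; exact: rintegrable_dot.
- exact: rintegrable_dot.
- by apply: filterS ae_dot_ge0 => x A0 _; rewrite mul0r.
Qed.

Lemma Rintegral_dot_subset D E f : measurable D -> measurable E -> E `<=` D ->
  square_integrable D f ->
  \int[mu]_(x in E) dot (A x *m f x) (f x) <= \int[mu]_(x in D) dot (A x *m f x) (f x).
Proof.
move=> mD mE ED If; have Id := rintegrable_dot mD If If.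
rewrite -[E in leLHS](setIidr ED) Rintegral_mkcondr; apply: ae_le_Rintegral => //.
- apply: (@rintegrable_le _ _ _ _ _ mD _ (fun x => `|dot (A x *m f x) (f x)|)).
  + apply/measurable_restrict => //;
    apply: measurable_funS (rintegrable_measurable Id) => //.
  + by move=> x Dx; rewrite patchE; case: ifP => // _; rewrite normr0.
  + exact: rintegrable_norm.
- by apply: filterS ae_dot_ge0 => x A0 _; rewrite patchE; case: ifP.
Qed.

Lemma Rintegral_dot_evec D k : measurable D -> (mu D < +oo)%E ->
  \int[mu]_(x in D) dot (A x *m evec R k) (evec R k) <= beta * fine (mu D).
Proof.
move=> mD Dfin; rewrite -(Rintegral_cst _ mD); apply: ae_le_Rintegral => //.
- by apply: rintegrable_dot => //; exact: square_integrable_cst.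
- exact: rintegrable_cst.
- by apply: filterS ae_dot_le => x /(_ (evec R k)) + _; rewrite dot_evec mulr1.
Qed.

Lemma Rintegral_dot_amgm D f g (s : R) : 0 < s -> measurable D ->
  square_integrable D f -> square_integrable D g ->
  `|\int[mu]_(x in D) dot (A x *m f x) (g x)| <=
  s / 2 * \int[mu]_(x in D) dot (A x *m f x) (f x) +
  (2 * s)^-1 * \int[mu]_(x in D) dot (A x *m g x) (g x).
Proof.
move=> s0 mD If Ig.
have Ifg := rintegrable_dot mD If Ig.
have Iff := rintegrable_dot mD If If.
have Igg := rintegrable_dot mD Ig Ig.
rewrite (le_trans (le_normr_Rintegral mD Ifg))//.
rewrite -!RintegralZl// -RintegralD//; [|exact: rintegrableZ..].
apply: ae_le_Rintegral => //; first exact: rintegrable_norm.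
- by apply: rintegrableD => //; exact: rintegrableZ.
- by apply: filterS2 symA ae_dot_ge0 => x sA A0 _; exact: dot_amgm.
Qed.

Lemma Rintegral_dot_linl D a f g h : measurable D -> square_integrable D f ->
  square_integrable D g -> square_integrable D h ->
  \int[mu]_(x in D) dot (A x *m (a *: f x + g x)) (h x) =
  a * \int[mu]_(x in D) dot (A x *m f x) (h x) +
  \int[mu]_(x in D) dot (A x *m g x) (h x).
Proof.
move=> mD If Ig Ih; rewrite -Rintegral_lin//; try exact: rintegrable_dot.
by apply: eq_Rintegral => x _; rewrite mulmxDr -scalemxAr dot_linl.
Qed.

Lemma aform_linl a u v w : H1per u -> H1per v -> H1per w ->
  aform A (a *: u + v) w = a * aform A u w + aform A v w.
Proof.
move=> hu hv hw; rewrite /aform.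
rewrite -Rintegral_dot_linl//; try exact: measurable_Omega;
  exact: H1per_square_integrable.
Qed.

Lemma aform_ge0 u : H1per u -> 0 <= aform A u u.
Proof.
move=> hu; apply: Rintegral_dot_ge0; first exact: measurable_Omega.
exact: H1per_square_integrable.
Qed.

Lemma enorm_sqr u : H1per u -> enorm A u ^+ 2 = aform A u u.
Proof. by move=> hu; rewrite sqr_sqrtr// aform_ge0. Qed.

(** Young inequality with weight 1 between $e_j$ and the gradient on [Q], the gradient energy then
    being enlarged to [Omega]. The factor $1/2$ permits absorption when [u] is the corrector
    itself. *)
Lemma load_le (Q : set (plane R)) j u : measurable Q -> Q `<=` @Omega R -> H1per u ->
  load A Q j u <= 2^-1 * aform A u u + 2^-1 * (beta * fine (mu Q)).
Proof.
move=> mQ QO hu; have mO := @measurable_Omega R.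
have Iu := H1per_square_integrable hu.
have IuQ := square_integrableS mO mQ QO Iu.
have Qfin : (mu Q < +oo)%E.
  apply: le_lt_trans (le_measure mu _ _ QO) _; [exact: mem_set..|].
  by rewrite [X in (X < _)%E]leb2_Omega ltry.
have Ie := square_integrable_cst (evec R j) mQ Qfin.
rewrite (le_trans (ler_norm _))// (le_trans (Rintegral_dot_amgm ltr01 mQ Ie IuQ))//.
rewrite addrC !mulr1 mul1r lerD// ler_wpM2l ?invr_ge0//.
  exact: Rintegral_dot_subset.
exact: Rintegral_dot_evec.
Qed.

(** The weight [s] stays free so that the two terms can be balanced once the energy of [u] is known;
    the last term uses $|\Omega|=1$. *)
Lemma mean_flux_le u k (s : R) : 0 < s -> H1per u ->
  `|\int[mu]_(x in @Omega R) dot (A x *m u.2 x) (evec R k)| <=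
  s / 2 * aform A u u + (2 * s)^-1 * beta.
Proof.
move=> s0 hu; have mO := @measurable_Omega R.
have Iu := H1per_square_integrable hu.
have Ofin : (mu (@Omega R) < +oo)%E by rewrite [X in (X < _)%E]leb2_Omega ltry.
have Ie := square_integrable_cst (evec R k) mO Ofin.
rewrite (le_trans (Rintegral_dot_amgm s0 mO Iu Ie))// lerD2l ler_wpM2l//.
  by rewrite invr_ge0 mulr_ge0// ltW.
by rewrite (le_trans (Rintegral_dot_evec k mO Ofin))// leb2_Omega mulr1.
Qed.

End bilinear_form.

(** * Arbitrary norms on 2 by 2 matrices *)

Section matrix_norm.
Context (R : realType) (nrm : 'M[R]_2 -> R).
Hypothesis Hnrm : is_mxnorm nrm.

Lemma mxnorm0 : nrm 0 = 0.
Proof. by have [_ nZ _] := Hnrm; rewrite -(scale0r 0) nZ normr0 mul0r. Qed.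

Lemma mxnorm_ge0 M : 0 <= nrm M.
Proof.
have [_ nZ nD] := Hnrm; have := nD M (- M).
by rewrite subrr mxnorm0 -scaleN1r nZ normrN1 mul1r; lra.
Qed.

Lemma mxnorm_sum (I : Type) (s : seq I) (P : pred I) (F : I -> 'M[R]_2) :
  nrm (\sum_(i <- s | P i) F i) <= \sum_(i <- s | P i) nrm (F i).
Proof.
have [_ _ nD] := Hnrm.
elim/big_ind2: _ => [|x1 x2 y1 y2 h1 h2|//]; first by rewrite mxnorm0.
by rewrite (le_trans (nD _ _))// lerD.
Qed.

(** Expansion in the matrix units; the constant is the sum of their norms. *)
Lemma mxnorm_entries (M : 'M[R]_2) (B : R) : (forall k j, `|M k j| <= B) ->
  nrm M <= (\sum_k \sum_j nrm (delta_mx k j)) * B.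
Proof.
move=> MB; have [_ nZ _] := Hnrm.
rewrite [in leLHS](matrix_sum_delta M) (le_trans (mxnorm_sum _ _ _))// mulr_suml.
apply: ler_sum => k _; rewrite (le_trans (mxnorm_sum _ _ _))// mulr_suml.
by apply: ler_sum => j _; rewrite nZ mulrC ler_wpM2l// mxnorm_ge0.
Qed.

End matrix_norm.

(** * Squares, cells and piecewise constant matrices *)

Section mesh.
Context (R : realType) (N : nat) (H : R).
Hypothesis HN : H = N%:R^-1.

Lemma mesh_size_gt0 (Q : idx N) : 0 < H.
Proof. by rewrite HN invr_gt0 ltr0n (leq_ltn_trans _ (ltn_ord Q.1)). Qed.

Lemma square_sub_Omega (Q : idx N) : square H (coords Q) `<=` @Omega R.
Proof.
have H0 := mesh_size_gt0 Q.
have L (i : 'I_N) : 0 <= (Posz i)%:~R * H by rewrite mulr_ge0// ltW.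
have U (i : 'I_N) : (Posz i + 1)%:~R * H <= 1.
  have N0 : 0 < N%:R :> R by rewrite ltr0n (leq_ltn_trans _ (ltn_ord i)).
  rewrite HN ler_pdivrMr// mul1r -[N%:R]/((Posz N)%:~R) ler_int.
  by rewrite lezD1 ltz_nat.
move=> x [/andP[x1 x1'] /andP[x2 x2']]; split; apply/andP; split.
- exact: le_trans (L _) x1.
- exact: le_trans x1' (U _).
- exact: le_trans (L _) x2.
- exact: le_trans x2' (U _).
Qed.

Lemma leb2_square s : 0 < H -> leb2 R (square H s) = (H ^+ 2)%:E.
Proof.
move=> H0; have le k : k%:~R * H <= (k + 1)%:~R * H.
  by rewrite (ler_pM2r H0) ler_int; lia.
rewrite squareE leb2_rect// !intrD; congr EFin; ring.
Qed.

Lemma cell_inj s t (x : plane R) : 0 < H -> cell H s x -> cell H t x -> s = t.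
Proof.
move=> H0; case: s t => [s1 s2] [t1 t2].
move=> [/= /andP[a1 a2] /andP[b1 b2]] [/= /andP[c1 c2] /andP[e1 e2]].
have lt (k k' : int) (y : R) : k%:~R * H <= y -> y < (k' + 1)%:~R * H -> (k <= k')%R.
  move=> ky yk; have := le_lt_trans ky yk; rewrite (ltr_pM2r H0) ltr_int; lia.
have := lt _ _ _ a1 c2; have := lt _ _ _ c1 a2.
have := lt _ _ _ b1 e2; have := lt _ _ _ e1 b2.
by move=> ? ? ? ?; congr (_, _); lia.
Qed.

Lemma coords_inj : injective (@coords N).
Proof. by move=> [i j] [k l] [] /val_inj -> /val_inj ->. Qed.

(** A point lies in at most one cell, so at most one term of the difference survives; off all cells
    both functions are zero. *)
Lemma pwconst_le (F G : idx N -> 'M[R]_2) (B : R) : 0 <= B ->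
  (forall Q k j, `|F Q k j - G Q k j| <= B) ->
  forall x k j, `|(pwconst H F x - pwconst H G x) k j| <= B.
Proof.
move=> B0 FG x k j.
rewrite /pwconst -sumrB summxE.
have E Q : (\1_(cell H (coords Q)) x *: F Q - \1_(cell H (coords Q)) x *: G Q) k j =
    \1_(cell H (coords Q)) x * (F Q k j - G Q k j) by rewrite !mxE mulrBr.
have [[Q xQ]|nQ] := pselect (exists Q : idx N, cell H (coords Q) x); last first.
  rewrite big1 ?normr0// => Q _; rewrite E indicE memNset ?mul0r// => xQ.
  by apply: nQ; exists Q.
rewrite (bigD1 Q)//= big1 ?addr0 => [|P PQ].
  by rewrite E indicE mem_set// mul1r.
rewrite E indicE memNset ?mul0r// => xP; move/eqP: PQ; apply.
by apply: coords_inj; exact: cell_inj (mesh_size_gt0 Q) xP xQ.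
Qed.

End mesh.

(** * Uniform bounds, the rescaled coefficient and the logarithmic choice of $\ell$ *)

Lemma Linf_le (R : realType) (nrm : 'M[R]_2 -> R) (M : plane R -> 'M[R]_2) (B : R) :
  is_mxnorm nrm -> 0 <= B -> (forall x, nrm (M x) <= B) -> (Linf nrm M <= B%:E)%E.
Proof.
move=> Hn B0 MB; rewrite /Linf unlock; case: ifPn => _; last by rewrite lee_fin.
apply/ess_supP; apply: aeW => x /=; rewrite patchE; case: ifP => _.
  by rewrite lee_fin ger0_norm// mxnorm_ge0.
by rewrite abse0 lee_fin.
Qed.

(** [rescale] is composition with an affine map of ratio $1/\varepsilon$, under which measurability
    and almost-everywhere properties transfer with the same constants. *)
Lemma coefficient_rescale (R : realType) (alpha beta eps : R) (A1 : plane R ->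
  'M[R]_2) :
  0 < eps -> coefficient alpha beta A1 ->
  [/\ forall k j, measurable_fun setT (fun x => rescale eps A1 x k j),
      \forall x \ae leb2 R, (rescale eps A1 x)^T = rescale eps A1 x &
      \forall x \ae leb2 R, forall xi : 'cV[R]_2, alpha * dot xi xi <=
        dot xi (rescale eps A1 x *m xi) <= beta * dot xi xi].
Proof.
move=> e0 [mA1 _ _ sA1 eA1]; have ei0 : 0 < eps^-1 by rewrite invr_gt0.
have -> : rescale eps A1 = A1 \o affine_map eps^-1 0 0.
  by apply/funext => x; rewrite /rescale /affine_map /= !addr0 ![eps^-1 * _]mulrC.
split; last 2 first.
- exact: (ae_affine 0 0 ei0 sA1).
- exact: (ae_affine 0 0 ei0 eA1).
- by move=> k j; apply: (measurableT_comp (mA1 k j) (measurable_affine_map eps^-1 0 0)).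
Qed.

(** After taking logarithms the claim reads $\ell\ln\gamma\le 2\ln H$, where neither logarithm is
    positive. *)
Lemma expr_le_sqr_of_log (R : realType) (gamma H : R) (l : nat) :
  0 < gamma < 1 -> 0 < H <= 1 -> 2 / `|ln gamma| * `|ln H| <= l%:R ->
  gamma ^+ l <= H ^+ 2.
Proof.
move=> /andP[g0 g1] /andP[H0 H1].
have lg : ln gamma < 0 by rewrite ln_lt0// g0 g1.
have lH : ln H <= 0 by rewrite ln_le0.
rewrite ltr0_norm// ler0_norm// => hl.
rewrite -ler_ln ?posrE ?exprn_gt0// !lnXn//.
have := hl; rewrite mulrAC ler_pdivrMr ?oppr_gt0// => h.
by rewrite -[leLHS]mulr_natl mulr2n; lra.
Qed.

(** * Errors of the localized correctors and of the coefficient *)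

Section corrector_error.
Context (R : realType) (alpha beta theta gamma : R) (A : plane R -> 'M[R]_2).
Context (d : bool) (N : nat) (H : R).
Local Notation mu := (leb2 R).
Hypothesis alpha0 : 0 < alpha.
Hypothesis beta0 : 0 <= beta.
Hypothesis gamma0 : 0 < gamma.
Hypothesis mA : forall k j, measurable_fun setT (fun x => A x k j).
Hypothesis symA : \forall x \ae mu, (A x)^T = A x.
Hypothesis ellA : \forall x \ae mu, forall xi : 'cV[R]_2,
  alpha * dot xi xi <= dot xi (A x *m xi) <= beta * dot xi xi.
Hypothesis HN : H = N%:R^-1.
Hypothesis contr : energy_contraction A d N H theta gamma.
Variables (qinf : idx N -> 'I_2 -> jet R) (q : nat -> idx N -> 'I_2 -> jet R).
Hypothesis qinfP : ideal_correctors A d H qinf.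
Hypothesis qP : localized_correctors A d H theta q.

(** Membership of the iterate in $W$ is carried through the induction because the contraction is
    available for errors in $W$. *)
Lemma localized_corrector_error l Q j :
  inW d H (q l Q j) /\
  enorm A (qinf Q j - q l Q j) <= gamma ^+ l * enorm A (qinf Q j).
Proof.
have H0 := mesh_size_gt0 HN Q.
have [wi iE] := qinfP Q j; have [C CP] := qP; have [q0 qS] := CP Q j.
elim: l => [|l [wl IH]].
  rewrite q0 expr0 mul1r subr0; split => //.
  by rewrite -(addNr (qinf Q j)) -scaleN1r; exact: inW_lin.
have [Cl ->] := qS l.
have wC i : inW d H (C l Q j i) by have [/(inWz_inW H0)] := Cl i.
have wS : inW d H (\sum_i C l Q j i) by exact: inW_sum wi wC.
split; first by rewrite addrC; exact: inW_lin.
have we : inW d H (qinf Q j - q l Q j) by rewrite addrC -scaleN1r; exact: inW_lin.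
(* For [w] in $W_i\subset W$ the load equals $a(q^\infty,w)$, so the problem defining $C_i$ is that
   of the projection of the error. *)
have proj i : is_proj A d H (coords i) (qinf Q j - q l Q j) (C l Q j i).
  have [zi ci] := Cl i; split => // w zw.
  have ww := inWz_inW H0 zw.
  rewrite ci// -iE// [qinf Q j - _]addrC -[- q l Q j]scaleN1r.
  rewrite (aform_linl alpha0 mA symA ellA); first 1 last.
  - by case: wl.
  - by case: wi.
  - by case: ww.
  by rewrite mulN1r addrC.
(* The new error is the old one minus [theta] times the sum of its projections. *)
have := contr we proj; rewrite opprD addrA => /le_trans; apply.
by rewrite exprS -mulrA ler_wpM2l// ltW.
Qed.

(** Tested with itself, the corrector satisfies $a\le\frac12a+\frac12\beta H^2$ for its energy $a$,
    and half of the energy is absorbed. *)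
Lemma ideal_corrector_energy Q j : aform A (qinf Q j) (qinf Q j) <= beta * H ^+ 2.
Proof.
have H0 := mesh_size_gt0 HN Q; have [wi iE] := qinfP Q j.
have hi : H1per (qinf Q j) by case: wi.
have mQ : measurable (square H (coords Q)) by exact: measurable_rect.
have := load_le alpha0 mA symA ellA j mQ (@square_sub_Omega _ _ _ HN Q) hi.
by rewrite leb2_square//= -iE//; lra.
Qed.

Lemma coef_on_error l Q k j : gamma ^+ l <= H ^+ 2 ->
  `|coef_on A H qinf Q k j - coef_on A H (q l) Q k j| <= beta * H.
Proof.
move=> glH; have H0 := mesh_size_gt0 HN Q; have [wi iE] := qinfP Q j.
have [wl el] := localized_corrector_error l Q j.
have we : inW d H (qinf Q j - q l Q j) by rewrite addrC -scaleN1r; exact: inW_lin.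
have he : H1per (qinf Q j - q l Q j) by case: we.
have hi : H1per (qinf Q j) by case: wi.
have hl : H1per (q l Q j) by case: wl.
have mO := @measurable_Omega R.
have Ofin : (mu (@Omega R) < +oo)%E by rewrite [X in (X < _)%E]leb2_Omega ltry.
have E2 : aform A (qinf Q j - q l Q j) (qinf Q j - q l Q j) <=
    (gamma ^+ l) ^+ 2 * (beta * H ^+ 2).
  rewrite -(enorm_sqr alpha0 mA symA ellA he).
  apply: (@le_trans _ _ ((gamma ^+ l * enorm A (qinf Q j)) ^+ 2)).
    by rewrite ler_sqr ?nnegrE ?sqrtr_ge0// mulr_ge0 ?sqrtr_ge0// exprn_ge0// ltW.
  rewrite exprMn ler_wpM2l ?sqr_ge0// (enorm_sqr alpha0 mA symA ellA hi).
  exact: ideal_corrector_energy.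
set g := gamma ^+ l in glH E2 *.
have g0 : 0 < g by rewrite exprn_gt0.
(* The energy of the error is at most $g^2\beta H^2$; with this weight both terms of the flux bound
   are at most $\beta gH/2$. *)
have s0 : 0 < (g * H)^-1 by rewrite invr_gt0 mulr_gt0.
have flux := mean_flux_le alpha0 mA symA ellA k s0 he.
have fluxE : \int[mu]_(x in @Omega R) dot (A x *m (qinf Q j - q l Q j).2 x) (evec R k) =
    \int[mu]_(x in @Omega R) dot (A x *m (qinf Q j).2 x) (evec R k) -
    \int[mu]_(x in @Omega R) dot (A x *m (q l Q j).2 x) (evec R k).
  rewrite -RintegralB//; last 2 first.
  - apply: (rintegrable_dot alpha0 mA symA ellA) => //;
      last exact: square_integrable_cst.
    exact: H1per_square_integrable.
  - apply: (rintegrable_dot alpha0 mA symA ellA) => //;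
      last exact: square_integrable_cst.
    exact: H1per_square_integrable.
  apply: eq_Rintegral => x _.
  rewrite [_.2 x](_ : _ = (-1) *: (q l Q j).2 x + (qinf Q j).2 x); last first.
    by rewrite scaleN1r addrC.
  by rewrite mulmxDr -scalemxAr dot_linl mulN1r addrC.
rewrite fluxE in flux; rewrite !mxE.
set i1 := \int[mu]_(x in _) _ in flux *; set i2 := \int[mu]_(x in _) _ in flux *.
set i0 := \int[mu]_(x in _) _.
(* The mean of $A_\varepsilon$ over the square cancels; only the difference of the fluxes
   remains. *)
rewrite [X in `|X|](_ : _ = - ((H ^+ 2)^-1 * (i1 - i2))); last by ring.
rewrite normrN normrM gtr0_norm ?invr_gt0 ?exprn_gt0// ler_pdivrMl ?exprn_gt0//.
apply: (le_trans flux).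
apply: (@le_trans _ _ ((g * H)^-1 / 2 * (g ^+ 2 * (beta * H ^+ 2)) +
  (2 * (g * H)^-1)^-1 * beta)).
  by rewrite lerD2r ler_wpM2l// divr_ge0// ltW.
(* The assumption $g\le H^2$ pays for the factor $H^{-2}$ of the mean over a square. *)
rewrite [leLHS](_ : _ = beta * H * g); last by field; rewrite !gt_eqF.
rewrite [leRHS](_ : _ = beta * H * H ^+ 2); last by ring.
by rewrite ler_wpM2l// mulr_ge0// ltW.
Qed.

End corrector_error.

(** * Choice of the constants $c_1$ and $C$ *)

Theorem proposition4p2 (R : realType) (d : bool) (nrm : 'M[R]_2 -> R)
    (alpha beta theta gamma : R) :
  is_mxnorm nrm -> 0 < alpha -> alpha <= beta ->
  0 < theta -> 0 < gamma -> gamma < 1 ->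
  exists c1 : R, 0 < c1 /\
  forall c2 : R, c1 <= c2 ->
  exists C : R, 0 < C /\
  forall A1 : plane R -> 'M[R]_2,
  coefficient alpha beta A1 ->
  (forall (N m : nat) (H eps : R), admissible N m H eps ->
     energy_contraction (rescale eps A1) d N H theta gamma) ->
  forall (N m l : nat) (H eps : R), admissible N m H eps ->
  c1 * `|ln H| <= l%:R -> l%:R <= c2 * `|ln H| ->
  forall (qinf : idx N -> 'I_2 -> jet R) (q : nat -> idx N -> 'I_2 -> jet R),
  ideal_correctors (rescale eps A1) d H qinf ->
  localized_correctors (rescale eps A1) d H theta q ->
  (Linf nrm (fun x =>
     (AH (rescale eps A1) H qinf x - AH (rescale eps A1) H (q l) x)%R)
   <= (C * H)%:E)%E.
Proof.
move=> Hn alpha0 alpha_beta theta0 gamma0 gamma1.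
have beta0 : 0 < beta by exact: lt_le_trans alpha_beta.
(* This is the factor required by [expr_le_sqr_of_log]; it depends on [gamma] alone. *)
exists (2 / `|ln gamma|); split.
  by rewrite divr_gt0// normr_gt0 lt_eqF// ln_lt0// gamma0.
move=> c2 _; set K := \sum_k \sum_j nrm (delta_mx k j).
have K0 : 0 <= K by rewrite sumr_ge0// => k _; rewrite sumr_ge0// => j _;
  exact: mxnorm_ge0.
(* [K] is the price of passing from entries to [nrm]; adding 1 makes the constant positive from [K]
   being nonnegative. *)
exists ((K + 1) * beta); split; first by rewrite mulr_gt0// ltr_wpDl.
move=> A1 cA1 contr N m l H eps adm lge _ qinf q qinfP qP.
have [N0 _ eps0 HN _] := adm.
have H0 : 0 < H by rewrite HN invr_gt0 ltr0n.
have H1 : H <= 1 by rewrite HN invf_le1 ?ler1n ?ltr0n.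
have glH : gamma ^+ l <= H ^+ 2.
  by apply: expr_le_sqr_of_log => //; [rewrite gamma0|rewrite H0].
have [mA symA ellA] := coefficient_rescale eps0 cA1.
have bH0 : 0 <= beta * H by rewrite mulr_ge0// ltW.
apply: Linf_le => //; first by rewrite !mulr_ge0 ?addr_ge0// ltW.
move=> x; apply: (@le_trans _ _ (K * (beta * H))); last first.
  by rewrite -mulrA ler_wpM2r// lerDl.
(* The pointwise norm is reduced to entries, and these to a single square. *)
apply: mxnorm_entries => // k j; apply: pwconst_le => // Q k' j'.
exact: (coef_on_error alpha0 (ltW beta0) gamma0 mA symA ellA HN
  (contr _ _ _ _ adm) qinfP qP).
Qed.
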